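(* Let $X,Y$ be Banach spaces. Then (1) $d_K(X^{**},Y^{**})\le d_K(X,Y)$; (2) for any fixed ultrafilter $\mathcal U$ on $\mathbb N$, $d_K(X_{\mathcal U},Y_{\mathcal U})\le d_K(X,Y)$; (3) $d_K(X^{**}/X,Y^{**}/Y)\le 8\,d_K(X,Y)$.
   Context: The Kadets distance $d_K(X,Y)$ is the infimum, over all Banach spaces $Z$ and linear isometric embeddings $U:X\to Z$, $V:Y\to Z$, of the Hausdorff distance in $Z$ between $UB_X$ and $VB_Y$ (closed unit balls). $X_{\mathcal U}$ denotes the ultrapower of $X$ with respect to $\mathcal U$, i.e. the quotient of $\ell_\infty(X)$ by the null space of the seminorm $\|(x_n)\|=\lim_{n\in\mathcal U}\|x_n\|_X$. $X$ is regarded as a subspace of $X^{**}$ via the canonical embedding. *)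

(* Defs.v *)
From HB Require Import structures.
From mathcomp Require Import all_boot all_order all_algebra.
From mathcomp Require Import all_classical all_reals all_analysis.
Set Implicit Arguments. Unset Strict Implicit. Unset Printing Implicit Defensive.
Import Order.TTheory GRing.Theory Num.Theory.
Import numFieldNormedType.Exports.
Local Open Scope classical_set_scope.
Local Open Scope ring_scope.

(* Normed spaces are presented in "pre-quotient" form: a carrier V (a vector
   space), a linear subspace S of V and a seminorm p on S.  The normed space
   meant is S / {p = 0} with the norm induced by p.  A linear isometric
   embedding of that normed space into a Banach space Z is exactly a map
   U : V -> Z that is linear on S and satisfies ||U v|| = p v on S
   (such a map vanishes on {p = 0}, hence factors through the quotient), and
   the image of the closed unit ball of the quotient is U @` [set v | S v /\ p v <= 1]. *)

Section Kadets.
Variable R : realType.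

Definition lin_isom_on (V : lmodType R) (S : set V) (p : V -> R)
    (Z : normedModType R) (U : V -> Z) : Prop :=
  [/\ (forall a b, S a -> S b -> U (a + b) = U a + U b),
      (forall (k : R) a, S a -> U (k *: a) = k *: U a) &
      (forall a, S a -> `|U a| = p a)].

Definition unit_ball (V : lmodType R) (S : set V) (p : V -> R) : set V :=
  [set v | S v /\ p v <= 1].

Definition dist_to_set (Z : normedModType R) (z : Z) (B : set Z) : \bar R :=
  ereal_inf [set (`|z - b|)%:E | b in B].

Definition hausdorff_dist (Z : normedModType R) (A B : set Z) : \bar R :=
  maxe (ereal_sup [set dist_to_set a B | a in A])
       (ereal_sup [set dist_to_set b A | b in B]).

Definition kadets_dist (V : lmodType R) (S : set V) (p : V -> R)
    (W : lmodType R) (T : set W) (q : W -> R) : \bar R :=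
  ereal_inf [set e | exists (Z : completeNormedModType R) (U : V -> Z) (U' : W -> Z),
    [/\ lin_isom_on S p U, lin_isom_on T q U' &
        e = hausdorff_dist (U @` unit_ball S p) (U' @` unit_ball T q)]].

(* Dual of a (pre-quotient) normed space (V,S,p): bounded linear functionals
   on S (represented as functions on V; those vanishing on S have norm 0),
   with the operator norm. *)
Definition dual_dom (V : lmodType R) (S : set V) (p : V -> R) : set (V -> R) :=
  [set f | [/\ (forall a b, S a -> S b -> f (a + b) = f a + f b),
               (forall (k : R) a, S a -> f (k *: a) = k * f a) &
               (exists C : R, forall a, S a -> `|f a| <= C * p a)]].

Definition dual_norm (V : lmodType R) (S : set V) (p : V -> R) (f : V -> R) : R :=
  sup [set `|f a| | a in unit_ball S p].

Definition sp_dom (X : normedModType R) : set X := setT.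
Definition sp_norm (X : normedModType R) (x : X) : R := `|x|.

Definition dual1_dom (X : normedModType R) := dual_dom (@sp_dom X) (@sp_norm X).
Definition dual1_norm (X : normedModType R) := dual_norm (@sp_dom X) (@sp_norm X).
Definition bidual_dom (X : normedModType R) := dual_dom (@dual1_dom X) (@dual1_norm X).
Definition bidual_norm (X : normedModType R) := dual_norm (@dual1_dom X) (@dual1_norm X).

Definition canon (X : normedModType R) (x : X) : (X -> R) -> R := fun f => f x.

Definition bidual_quot_norm (X : normedModType R) (phi : (X -> R) -> R) : R :=
  inf [set bidual_norm (phi - canon x) | x in [set: X]].

Definition linfty_dom (X : normedModType R) : set (nat -> X) :=
  [set x | exists M : R, forall n, `|x n| <= M].
Definition ultra_norm (X : normedModType R) (U : set_system nat) (x : nat -> X) : R :=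
  @lim R ((fun n => `|x n|) @ U).

End Kadets.

(* Main.v *)
Require Import Defs.
From HB Require Import structures.
From mathcomp Require Import all_boot all_order all_algebra.
From mathcomp Require Import all_classical all_reals all_analysis.
From mathcomp Require Import ring lra.
Set Implicit Arguments. Unset Strict Implicit. Unset Printing Implicit Defensive.
Import Order.TTheory GRing.Theory Num.Theory.
Import numFieldNormedType.Exports.
Local Open Scope classical_set_scope.
Local Open Scope ring_scope.

(* A pair of isometric embeddings [U], [U'] of two normed spaces into a common
   space is recorded by the seminorm [N x y = |U x - U' y|] on their product.
   Conversely, by the Hahn-Banach theorem, every convex cone that can serve as
   the epigraph of such a seminorm is realised by embeddings into a space of
   bounded functions.  So each bound on a Kadets distance amounts to exhibiting
   a cone.
   (1) Take the bidual seminorm of [N].  If every ball point of [X] is [d]-close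
   to a ball point of [Y], then the Hahn-Banach theorem on the dual of [Y] yields
   for each [phi] in [X**] a [psi] in [Y**] with [|psi| <= |phi|] and
   [|phi - psi| <= d |phi|].
   (2) Take the limit of [N (x n) (y n)] along the ultrafilter.
   (3) Take the gauge generated by both quotient norms and by the relation
   [|phi|, |psi| <= c, |phi - psi| <= d c] at height [3 d c].  It restricts to the
   quotient norms: if [y] in [Y] satisfies [|psi - y| = t <= c] then [|y| <= 2 c], so
   some [x] in [X] is within [2 d c] of [y], whence [|phi - x| <= t + 3 d c]. *)

(** * The Hahn-Banach theorem for convex cones *)

Section HahnBanach.
Variables (R : realType) (V : lmodType R) (S : set V).

Definition subspace_of : Prop :=
  [/\ S 0, (forall a b, S a -> S b -> S (a + b)) &
      (forall (k : R) a, S a -> S (k *: a))].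

(** A pair [(v, r)] in [K] is read as [q v <= r] for a sublinear [q]. Working with sets of pairs
    lets a bound be given by exhibiting witnesses, with no infimum to evaluate. *)
Definition convex_cone (K : set (V * R)) : Prop :=
  [/\ K (0, 0),
      (forall v w r s, K (v, r) -> K (w, s) -> K (v + w, r + s)) &
      (forall k v r, 0 < k -> K (v, r) -> K (k *: v, k * r))].

Definition linear_on (f : V -> R) : Prop :=
  (forall a b, S a -> S b -> f (a + b) = f a + f b) /\
  (forall (k : R) a, S a -> f (k *: a) = k * f a).

(** The last clause bounds the heights over [v] from below as soon as some height exists over
    [- v]. *)
Definition pointed_cone (K : set (V * R)) : Prop :=
  [/\ convex_cone K, (forall v r, K (v, r) -> S v) &
      (forall r, K (0, r) -> 0 <= r)].

Lemma pointed_cone_maximal (K : set (V * R)) : pointed_cone K ->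
  exists A, [/\ K `<=` A, pointed_cone A &
    forall B, pointed_cone B -> A `<=` B -> B `<=` A].
Proof.
move=> Kp.
(* Zorn's lemma is applied to the sets whose union with [K] is a pointed cone, so that the empty
   chain, with empty union, is admissible. *)
have [|A [Ap Amax]] := @Zorn_bigcup _ [set A | pointed_cone (K `|` A)].
  move=> F FP Ft.
  pose L := K `|` \bigcup_(X in F) X.
  have KL : K `<=` L by move=> x Kx; left.
  have FL B : F B -> K `|` B `<=` L by move=> FB x [Kx|Bx]; [left|right; exists B].
  have Lone x : L x -> exists B, [/\ pointed_cone B, B `<=` L & B x].
    by move=> [Kx|[B FB Bx]]; [exists K|exists (K `|` B); split; [exact: FP|exact: FL|right]].
  (* Each cone axiom involves at most two points, and along a chain these lie in a common pointed
     cone. *)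
  have Ltwo x y : L x -> L y -> exists B, [/\ pointed_cone B, B `<=` L, B x & B y].
    move=> [Kx|[B FB Bx]] [Ky|[C FC Cy]].
    - by exists K.
    - by exists (K `|` C); split; [exact: FP|exact: FL|left|right].
    - by exists (K `|` B); split; [exact: FP|exact: FL|right|left].
    - have [BC|CB] := Ft _ _ FB FC.
        by exists (K `|` C); split; [exact: FP|exact: FL|right; exact: BC|right].
      by exists (K `|` B); split; [exact: FP|exact: FL|right|right; exact: CB].
  split.
  - split; first by left; case: Kp => -[].
      move=> v w r s Lv Lw; have [B [[[_ BD _] _ _] BL Bv Bw]] := Ltwo _ _ Lv Lw.
      exact/BL/BD.
    move=> k v r k0 Lv; have [B [[[_ _ BZ] _ _] BL Bv]] := Lone _ Lv.
    exact/BL/BZ.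
  - by move=> v r /Lone [B [[_ BS _] _ /BS]].
  - by move=> r /Lone [B [[_ _ B0] _ /B0]].
exists (K `|` A); split => // B Bp KAB.
have KB : K `<=` B by move=> x Kx; apply: KAB; left.
have AB : A `<=` B by move=> x Ax; apply: KAB; right.
apply: contrapT => nBA; apply: (Amax B) => /=; last by rewrite (setUidr KB).
by split=> // BA; apply/nBA => x /BA; right.
Qed.

(** Adding the ray through [(- v, - m)] forces [m <= f v] for every linear [f] below the cone. *)
Definition adjoin (K : set (V * R)) (v : V) (m : R) : set (V * R) :=
  [set x | exists t w r, [/\ 0 <= t, K (w, r) & x = (w - t *: v, r - t * m)]].

Lemma sub_adjoin (K : set (V * R)) v m : K `<=` adjoin K v m.
Proof. by move=> [w r] Kw; exists 0, w, r; rewrite scale0r mul0r !subr0. Qed.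

Lemma adjoin_generator (K : set (V * R)) v m :
  K (0, 0) -> adjoin K v m (- v, - m).
Proof. by move=> K0; exists 1, 0, 0; rewrite scale1r mul1r !sub0r. Qed.

(** A point of the new cone over [0] with [t > 0] comes from [(t *: v, r)] in [K]; dividing by [t]
    gives [m <= r / t], so its height [r - t * m] is nonnegative. *)
Lemma pointed_cone_adjoin (K : set (V * R)) v m : subspace_of -> pointed_cone K ->
  S v -> (forall r, K (v, r) -> m <= r) -> pointed_cone (adjoin K v m).
Proof.
move=> [S0 SD SZ] [[K00 KD KZ] KS K0] Sv mK.
split; [split|..].
- exact: sub_adjoin.
- move=> _ _ _ _ [t [w [r [t0 Kw [-> ->]]]]] [t' [w' [r' [t'0 Kw' [-> ->]]]]].
  exists (t + t'), (w + w'), (r + r'); split; [exact: addr_ge0|exact: KD|].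
  by rewrite scalerDl mulrDl !opprD addrACA [X in (_, X)]addrACA.
- move=> k _ _ k0 [t [w [r [t0 Kw [-> ->]]]]].
  exists (k * t), (k *: w), (k * r); split; [by rewrite mulr_ge0// ltW|exact: KZ|].
  by rewrite scalerBr scalerA mulrBr mulrA.
- move=> _ _ [t [w [r [t0 /KS Sw [-> _]]]]]; apply: SD => //.
  by rewrite -scaleNr; exact: SZ.
- move=> _ [t [w [r [+ Kw [/esym/eqP + ->]]]]].
  rewrite subr_eq0 le_eqVlt => /predU1P[<-|t0] /eqP wE.
    by move: Kw; rewrite wE scale0r mul0r subr0 => /K0.
  rewrite subr_ge0 -ler_pdivlMl//; apply: mK.
  have -> : v = t^-1 *: w by rewrite wE scalerA mulVf ?scale1r// gt_eqF.
  by apply: KZ; rewrite ?invr_gt0.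
Qed.

(* In a maximal pointed cone [A] the infimum [q v] of the heights over [v] is
   odd: otherwise the ray through [(- v, - q v)] could be added to [A]. *)
Theorem hahn_banach_cone (K : set (V * R)) :
  subspace_of -> pointed_cone K ->
  (forall v, S v -> exists r, K (v, r)) ->
  exists2 f : V -> R, linear_on f & forall v r, K (v, r) -> f v <= r.
Proof.
move=> /[dup] Ssub [S0 SD SZ] Kp Ktot.
have [A [KA /[dup] Ap [[A00 AD AZ] AS A0] Amax]] := pointed_cone_maximal Kp.
have AT v : S v -> exists r, A (v, r) by move=> /Ktot [r /KA]; exists r.
have SN v : S v -> S (- v) by rewrite -scaleN1r; exact: SZ.
pose q v := inf [set r | A (v, r)].
have Alb v : S v -> has_lbound [set r | A (v, r)].
  move=> Sv; have [r Ar] := AT _ (SN _ Sv); exists (- r) => s /= As.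
  by have := AD _ _ _ _ As Ar; rewrite subrr => /A0; lra.
have qle v r : A (v, r) -> q v <= r.
  by move=> Ar; apply: ge_inf => //; apply: Alb; exact: AS Ar.
have lbq v c : S v -> (forall r, A (v, r) -> c <= r) -> c <= q v.
  by move=> Sv h; apply: lb_le_inf => //; exact: AT.
have q0 : q 0 = 0.
  by apply/eqP; rewrite eq_le qle//=; apply: lbq => // r /A0.
have AN v : S v -> A (- v, - q v).
  move=> Sv; apply: (Amax (adjoin A v (q v))); last 2 first.
  - exact: sub_adjoin.
  - exact: adjoin_generator.
  by apply: pointed_cone_adjoin => // r; exact: qle.
have qD v w : S v -> S w -> q (v + w) <= q v + q w.
  move=> Sv Sw; rewrite -lerBlDr; apply/lbq => // r Ar; rewrite lerBlDr [r + _]addrC -lerBlDr.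
  apply/lbq => // s As; rewrite lerBlDr [s + _]addrC; apply: qle; exact: AD.
have qN v : S v -> q (- v) = - q v.
  move=> Sv; apply/eqP; rewrite eq_le qle /=; last exact: AN.
  have := qD _ _ Sv (SN _ Sv); by rewrite subrr q0; lra.
have qZ k v : 0 < k -> S v -> q (k *: v) = k * q v.
  have qZ1 k' v' : 0 < k' -> S v' -> k' * q v' <= q (k' *: v').
    move=> k0 Sv; apply: lbq; first exact: SZ.
    move=> r Ar; rewrite -ler_pdivlMl//; apply: qle.
    have -> : v' = k'^-1 *: (k' *: v') by rewrite scalerA mulVf ?scale1r// gt_eqF.
    by apply: AZ => //; rewrite invr_gt0.
  move=> k0 Sv; apply/eqP; rewrite eq_le qZ1// andbT.
  have := qZ1 k^-1 (k *: v); rewrite invr_gt0 => /(_ k0 (SZ _ _ Sv)).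
  by rewrite scalerA mulVf ?scale1r ?gt_eqF// ler_pdivrMl.
exists q; last by move=> v r /KA; exact: qle.
split=> [v w Sv Sw|k v Sv].
  (* The reverse inequality is subadditivity at [- v] and [- w] combined with oddness. *)
  apply/eqP; rewrite eq_le qD//=.
  have := qD _ _ (SN _ Sv) (SN _ Sw).
  rewrite -opprD (qN _ (SD _ _ Sv Sw)) (qN _ Sv) (qN _ Sw); lra.
have [k0|k0|->] := ltgtP k 0; last by rewrite scale0r mul0r.
- rewrite -[k in LHS]opprK scaleNr (qN _ (SZ _ _ Sv)).
  by rewrite qZ ?oppr_gt0// mulNr opprK.
- exact: qZ.
Qed.

Corollary hahn_banach_cone_at (K : set (V * R)) (v : V) (m : R) :
  subspace_of -> pointed_cone K -> (forall w, S w -> exists r, K (w, r)) ->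
  S v -> (forall r, K (v, r) -> m <= r) ->
  exists f : V -> R, [/\ linear_on f, (forall w r, K (w, r) -> f w <= r) & m <= f v].
Proof.
move=> Ssub Kp Ktot Sv mK.
have [||f flin fK] := @hahn_banach_cone (adjoin K v m) Ssub.
- exact: pointed_cone_adjoin.
- by move=> w /Ktot [r Kw]; exists r; exact: sub_adjoin.
exists f; split=> //; first by move=> w r Kw; apply: fK; exact: sub_adjoin.
have : f (- v) <= - m by apply: fK; apply: adjoin_generator; case: Kp => -[].
by rewrite -scaleN1r flin.2// mulN1r lerN2.
Qed.

End HahnBanach.

(** * The Banach space of bounded functions *)

Section BoundedFunctions.
Variables (R : realType) (I : Type).

Definition bounded_pred : {pred I -> R} :=
  mem [set f : I -> R | exists M, forall i, `|f i| <= M].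

Lemma bounded_submod_closed : submod_closed bounded_pred.
Proof.
split=> [|k f g]; rewrite ?inE /=; first by exists 0 => i; rewrite normr0.
move=> [M fM] [N gN]; exists (`|k| * M + N) => i.
rewrite (le_trans (ler_normD _ _))// lerD// [in leLHS]/GRing.scale /= normrM.
by rewrite ler_wpM2l.
Qed.

HB.instance Definition _ :=
  GRing.isSubmodClosed.Build _ _ bounded_pred bounded_submod_closed.

Record bfun := Bfun { bfun_val :> I -> R; _ : bfun_val \in bounded_pred }.

HB.instance Definition _ := [isSub for bfun_val].
HB.instance Definition _ := [Choice of bfun by <:].
HB.instance Definition _ := [SubChoice_isSubLmodule of bfun by <:].

Lemma bfun_bounded (f : bfun) : exists M, forall i, `|f i| <= M.
Proof. by case: f => f /=; rewrite inE. Qed.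

(* The point [0] makes the supremum over an empty index type equal to [0]. *)
Definition bfun_norm (f : bfun) : R := sup (0 |` [set `|f i| | i in [set: I]]).

Lemma bfun_norm_has_sup (f : bfun) : has_sup (0 |` [set `|f i| | i in [set: I]]).
Proof.
split; first by exists 0; left.
have [M fM] := bfun_bounded f; exists (Num.max 0 M) => _ [->|[i _ <-]].
  by rewrite le_max lexx.
by rewrite le_max fM orbT.
Qed.

Lemma bfun_norm_ge (f : bfun) i : `|f i| <= bfun_norm f.
Proof. by apply: sup_upper_bound; [exact: bfun_norm_has_sup|right; exists i]. Qed.

Lemma bfun_norm_ge0 (f : bfun) : 0 <= bfun_norm f.
Proof. by apply: sup_upper_bound; [exact: bfun_norm_has_sup|left]. Qed.

Lemma bfun_norm_le (f : bfun) M :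
  0 <= M -> (forall i, `|f i| <= M) -> bfun_norm f <= M.
Proof.
move=> M0 fM; apply: ge_sup; first by have [] := bfun_norm_has_sup f.
by move=> _ [->|[i _ <-]].
Qed.

Lemma bfun_normD (f g : bfun) : bfun_norm (f + g) <= bfun_norm f + bfun_norm g.
Proof.
apply: bfun_norm_le => [|i]; first by rewrite addr_ge0// bfun_norm_ge0.
by rewrite (le_trans (ler_normD _ _))// lerD// bfun_norm_ge.
Qed.

Lemma bfun_normZ (k : R) (f : bfun) : bfun_norm (k *: f) = `|k| * bfun_norm f.
Proof.
(* One inequality suffices: applied to [k^-1] and [k *: f] it gives the converse. *)
have le_norm l g : bfun_norm (l *: g) <= `|l| * bfun_norm g.
  apply: bfun_norm_le => [|i]; first by rewrite mulr_ge0// bfun_norm_ge0.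
  by rewrite [in leLHS]/GRing.scale /= normrM ler_wpM2l// bfun_norm_ge.
apply/eqP; rewrite eq_le le_norm /=.
have [->|k0] := eqVneq k 0; first by rewrite normr0 mul0r bfun_norm_ge0.
have := le_norm k^-1 (k *: f).
by rewrite scalerA mulVf// scale1r normfV ler_pdivlMl ?normr_gt0.
Qed.

Lemma bfun_norm_eq0 (f : bfun) : bfun_norm f = 0 -> f = 0.
Proof.
move=> f0; apply/val_inj/funext => i /=; apply/eqP.
by rewrite -normr_eq0 eq_le normr_ge0 -f0 bfun_norm_ge.
Qed.

HB.instance Definition _ :=
  Lmodule_isNormed.Build R bfun bfun_normD bfun_normZ bfun_norm_eq0.

(** The limit is taken pointwise in [R]. A ball [ball g e] in [F] confines every coordinate of the
    limit to within [e] of [g], uniformly in the index, which gives both boundedness and convergence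
    in norm. *)
Lemma bfun_complete (F : set_system bfun) :
  ProperFilter F -> cauchy F -> cvg F.
Proof.
move=> FF Fc.
have Fball (e : R) : 0 < e -> exists g, F (ball g e).
  by move=> e0; have /cauchyP/(_ e e0) := Fc.
have evF i : cvg ((fun f : bfun => f i : R) @ F).
  apply: R_complete; apply/cauchyP => e e0.
  have [g Fg] := Fball _ e0; exists (g i).
  rewrite /= /nbhs/=; apply: filterS Fg => f; rewrite -!ball_normE /=.
  by apply: le_lt_trans; exact: (bfun_norm_ge (g - f)).
pose l i : R := lim ((fun f : bfun => f i : R) @ F).
have lF (g : bfun) e : F (ball g e) -> forall i, `|l i - g i| <= e.
  move=> Fg i; rewrite ler_distl; apply/andP; split.
    apply: limr_ge; first exact: evF.
    apply: filterS Fg => f; rewrite -ball_normE /= => /ltW gf.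
    have : `|g i - f i| <= e := le_trans (bfun_norm_ge (g - f) i) gf.
    by rewrite ler_norml => /andP[]; lra.
  apply: limr_le; first exact: evF.
  apply: filterS Fg => f; rewrite -ball_normE /= => /ltW gf.
  have : `|g i - f i| <= e := le_trans (bfun_norm_ge (g - f) i) gf.
  by rewrite ler_norml => /andP[]; lra.
have lb : l \in bounded_pred.
  have [g Fg] := Fball _ ltr01; have [M gM] := bfun_bounded g.
  rewrite inE /=; exists (1 + M) => i.
  rewrite -[l i](subrK (g i)) (le_trans (ler_normD _ _))// lerD//; exact: lF.
apply/cvg_ex; exists (Bfun lb); apply/cvgrPdist_le => /= e e0.
have e20 : 0 < e / 2 by rewrite divr_gt0.
have [g Fg] := Fball _ e20; apply: filterS (Fg) => f; rewrite -ball_normE /= => gf.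
apply: bfun_norm_le => [|i /=]; first exact: ltW.
rewrite [leLHS](_ : _ = `|(l i - g i) + (g i - f i)|); last by rewrite addrA subrK.
rewrite [e]splitr (le_trans (ler_normD _ _))// lerD//; first exact: lF.
exact: le_trans (bfun_norm_ge (g - f) i) (ltW gf).
Qed.

HB.instance Definition _ := Uniform_isComplete.Build bfun bfun_complete.

End BoundedFunctions.

(** * Kadets distance bounds from convex cones *)

Section Gluing.
Variables (R : realType) (V W : lmodType R) (S : set V) (T : set W).
Variables (p : V -> R) (q : W -> R) (K : set (V * W * R)).

(* [K] plays the role of the epigraph [{(v, w, r) | |U v - U' w| <= r}] of a
   seminorm inducing [p] and [q] on the two factors. *)
Definition gluing_cone : Prop :=
  [/\ convex_cone K,
      (forall v w r, K (v, w, r) -> S v /\ T w),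
      (forall v w r, K (v, w, r) -> K (- v, - w, r)),
      (forall v, S v -> (forall r, K (v, 0, r) -> p v <= r) /\
                        (forall r, p v < r -> K (v, 0, r))) &
      (forall w, T w -> (forall r, K (0, w, r) -> q w <= r) /\
                        (forall r, q w < r -> K (0, w, r)))].

Hypotheses (Ssub : subspace_of S) (Tsub : subspace_of T) (Kg : gluing_cone).

Let ST : set (V * W) := [set x | S x.1 /\ T x.2].

Let STsub : subspace_of ST.
Proof.
case: Ssub Tsub => S0 SD SZ [T0 TD TZ]; split => //.
- by move=> a b [? ?] [? ?]; split; [exact: SD|exact: TD].
- by move=> k a [? ?]; split; [exact: SZ|exact: TZ].
Qed.

(** The inequality [0 <= p 0] is drawn from the cone: if [p 0 < 0], then [p 0 / 2] is a height over
    [0], hence so is [2 * p 0], which lies below [p 0]. Adding a point of [K] to its reflection then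
    gives [p 0 <= 2 * r]. *)
Let K_ge0 x r : K (x, r) -> 0 <= r.
Proof.
case: Kg => [[K0 KD KZ] KS KN Kp _]; case: x => v w Kx.
have p0 : 0 <= p 0.
  rewrite leNgt; apply/negP => p0; have [S0 _ _] := Ssub.
  have [/(_ _ K0) p0' h] := Kp _ S0.
  have h1 : K (0, 0, p 0 / 2) by apply: h; lra.
  have := KZ 4 _ _ _ h1; rewrite scaler0.
  have -> : 4 * (p 0 / 2) = 2 * p 0 by lra.
  by move=> /(_ ltac:(lra)) /(Kp _ S0).1; lra.
have := KD _ _ _ _ Kx (KN _ _ _ Kx); rewrite [X in (X, _)](_ : _ = 0); last first.
  by congr (_, _); rewrite /= subrr.
by have [S0 _ _] := Ssub; move=> /(Kp _ S0).1; lra.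
Qed.

Let Kpointed : pointed_cone ST K.
Proof.
case: (Kg) => [Kc KS _ _ _]; split => // [[v w] r /KS//|r]; exact: K_ge0.
Qed.

Let Ktotal x : ST x -> exists r, K (x, r).
Proof.
case: Kg => [[K0 KD _] _ _ Kp Kq]; case: x => v w [/= Sv Tw].
have Kv : K (v, 0, p v + 1) by apply: (Kp _ Sv).2; rewrite ltrDl.
have Kw : K (0, w, q w + 1) by apply: (Kq _ Tw).2; rewrite ltrDl.
exists ((p v + 1) + (q w + 1)); have := KD _ _ _ _ Kv Kw.
by rewrite [X in (X, _)](_ : _ = (v, w))//; congr (_, _); rewrite /= ?addr0 ?add0r.
Qed.

Let dual (F : V * W -> R) : Prop :=
  linear_on ST F /\ forall x r, K (x, r) -> F x <= r.

Let dual_abs F v w r : dual F -> K (v, w, r) -> `|F (v, w)| <= r.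
Proof.
move=> [[FD FZ] FK] Kx; case: (Kg) => [_ KS KN _ _].
have STx : ST (v, w) by have [? ?] := KS _ _ _ Kx.
rewrite ler_norml (FK _ _ Kx) andbT lerNl.
by have := FK _ _ (KN _ _ _ Kx); rewrite -[X in F X]/(- (v, w)) -scaleN1r FZ// mulN1r.
Qed.

(** Evaluation of [x] on the functionals dominated by [K]. The index type is all functions, with
    value [0] at the others; the default of [insubd] can occur only outside [ST], where boundedness
    is not guaranteed. *)
Let pair (x : V * W) : bfun R (V * W -> R) :=
  insubd 0 (fun F => if `[< dual F >] then F x else 0).

Let pairE x F : ST x -> pair x F = if `[< dual F >] then F x else 0.
Proof.
move=> STx; rewrite /pair/= val_insubd ifT// inE /=.
have [r Kx] := Ktotal STx; exists r => G; case: ifPn => [/asboolP dG|_].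
  by case: x Kx {STx} => v w; exact: dual_abs.
by rewrite normr0; exact: K_ge0 Kx.
Qed.

Let pairD x y : ST x -> ST y -> pair (x + y) = pair x + pair y.
Proof.
move=> Sx Sy; have [_ STD _] := STsub; apply/val_inj/funext => F.
change (pair (x + y) F = pair x F + pair y F).
rewrite !pairE//; last exact: STD.
by case: asboolP => [[[FD _] _]|_]; [rewrite FD|rewrite addr0].
Qed.

Let pairZ k x : ST x -> pair (k *: x) = k *: pair x.
Proof.
move=> Sx; have [_ _ STZ] := STsub; apply/val_inj/funext => F.
change (pair (k *: x) F = k * pair x F).
rewrite !pairE//; last exact: STZ.
by case: asboolP => [[[_ FZ] _]|_]; [rewrite FZ|rewrite mulr0].
Qed.

Let pair_norm_le x r : K (x, r) -> `|pair x| <= r.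
Proof.
move=> Kx; apply: bfun_norm_le => [|F]; first exact: K_ge0 Kx.
case: (Kg) => [_ KS _ _ _].
rewrite pairE; last by case: x Kx => v w /KS.
case: asboolP => [dF|_]; last by rewrite normr0; exact: K_ge0 Kx.
by case: x Kx => v w; exact: dual_abs.
Qed.

(** The Hahn-Banach theorem supplies a dominated functional with value at least [m] at [x], which is
    one of the coordinates of [pair x]. *)
Let pair_norm_ge x m : ST x -> (forall r, K (x, r) -> m <= r) -> m <= `|pair x|.
Proof.
move=> STx mK.
have [F [Flin FK mF]] := hahn_banach_cone_at STsub Kpointed Ktotal STx mK.
apply: (le_trans mF); apply: le_trans (bfun_norm_ge (pair x) F).
by rewrite pairE// asboolT// ler_norm.
Qed.

(** Heights [s > r] are used because heights obtained from infima or limits are reached only up to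
    an arbitrarily small error. *)
Lemma kadets_dist_le_gluing (r : R) :
  (forall v, unit_ball S p v ->
    exists2 w, unit_ball T q w & forall s, r < s -> K (v, w, s)) ->
  (forall w, unit_ball T q w ->
    exists2 v, unit_ball S p v & forall s, r < s -> K (v, w, s)) ->
  (kadets_dist S p T q <= r%:E)%E.
Proof.
move=> VW WV.
have [S0 SD SZ] := Ssub; have [T0 TD TZ] := Tsub.
have [_ _ KN Kp Kq] := Kg.
(* The sign makes [U v - U' w] equal to [pair (v, w)], which [K] controls directly. *)
pose U v := pair (v, 0); pose U' w := - pair (0, w).
have SV v : S v -> ST (v, 0) by [].
have TW w : T w -> ST (0, w) by [].
have UU' v w : S v -> T w -> U v - U' w = pair (v, w).
  move=> Sv Tw; rewrite /U /U' opprK -pairD; [|exact: SV|exact: TW].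
  by congr pair; congr (_, _); rewrite /= ?addr0 ?add0r.
have dist_le v w : S v -> T w -> (forall s, r < s -> K (v, w, s)) ->
    `|U v - U' w| <= r.
  move=> Sv Tw Kvw; rewrite UU'//; apply/ler_addgt0Pr => e e0.
  by apply/pair_norm_le/Kvw; rewrite ltrDl.
have UP : lin_isom_on S p U.
  split=> [a b Sa Sb|k a Sa|a Sa].
  - rewrite /U -pairD; [|exact: SV..].
    by congr pair; congr (_, _); rewrite /= addr0.
  - rewrite /U -pairZ; last exact: SV.
    by congr pair; congr (_, _); rewrite /= scaler0.
  - apply/eqP; rewrite eq_le; apply/andP; split.
      apply/ler_addgt0Pr => e e0.
      by apply/pair_norm_le/(Kp _ Sa).2; rewrite ltrDl.
    apply: pair_norm_ge; [exact: SV|by have [] := Kp _ Sa].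
have UP' : lin_isom_on T q U'.
  split=> [a b Ta Tb|k a Ta|a Ta].
  - rewrite /U' -opprD -pairD; [|exact: TW..].
    by congr (- pair _); congr (_, _); rewrite /= addr0.
  - rewrite /U' scalerN -pairZ; last exact: TW.
    by congr (- pair _); congr (_, _); rewrite /= scaler0.
  - rewrite /U' normrN; apply/eqP; rewrite eq_le; apply/andP; split.
      apply/ler_addgt0Pr => e e0.
      by apply/pair_norm_le/(Kq _ Ta).2; rewrite ltrDl.
    apply: pair_norm_ge; [exact: TW|by have [] := Kq _ Ta].
apply: (@le_trans _ _ (hausdorff_dist (U @` unit_ball S p) (U' @` unit_ball T q))).
  by apply: ereal_inf_lbound; exists (bfun R (V * W -> R)), U, U'.
rewrite /hausdorff_dist ge_max; apply/andP; split; apply: ge_ereal_sup => /=.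
- move=> _ [_ [v vB <-] <-]; have [w wB Kvw] := VW _ vB.
  apply: (@le_trans _ _ (`|U v - U' w|)%:E).
    by apply: ereal_inf_lbound; exists (U' w) => //; exists w.
  by rewrite lee_fin dist_le//; [case: vB|case: wB].
- move=> _ [_ [w wB <-] <-]; have [v vB Kvw] := WV _ wB.
  apply: (@le_trans _ _ (`|U' w - U v|)%:E).
    by apply: ereal_inf_lbound; exists (U v) => //; exists v.
  by rewrite distrC lee_fin dist_le//; [case: vB|case: wB].
Qed.

End Gluing.

(** * Dual norms *)

Section DualSeminorm.
Variables (R : realType) (V : lmodType R) (S : set V) (p : V -> R).

Definition seminorm_on : Prop :=
  (forall a b, S a -> S b -> p (a + b) <= p a + p b) /\
  (forall (k : R) a, S a -> p (k *: a) = `|k| * p a).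

Hypotheses (Ssub : subspace_of S) (pS : seminorm_on).

Lemma seminorm_ge0 a : S a -> 0 <= p a.
Proof.
case: Ssub pS => _ _ SZ [pD pZ] Sa.
have := pD _ _ Sa (SZ (-1) _ Sa); rewrite pZ// normrN1 mul1r.
by rewrite -[a in p (a + _)]scale1r -scalerDl subrr pZ// normr0 mul0r; lra.
Qed.

Lemma seminorm_opp a : S a -> p (- a) = p a.
Proof. by move=> Sa; rewrite -scaleN1r pS.2// normrN1 mul1r. Qed.

Lemma seminorm0 : p 0 = 0.
Proof. by case: Ssub => S0 _ _; rewrite -(scale0r 0) pS.2// normr0 mul0r. Qed.

Lemma linear_on0 (f : V -> R) : linear_on S f -> f 0 = 0.
Proof. by case: Ssub => S0 _ _ fl; rewrite -(scale0r 0) fl.2// mul0r. Qed.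

Lemma linear_onN (f : V -> R) a : linear_on S f -> S a -> f (- a) = - f a.
Proof. by move=> fl Sa; rewrite -scaleN1r fl.2// mulN1r. Qed.

Lemma dual_dom_linear f : dual_dom S p f -> linear_on S f.
Proof. by case. Qed.

Lemma dual_norm_has_sup f : dual_dom S p f -> has_sup [set `|f a| | a in unit_ball S p].
Proof.
case: Ssub => S0 _ _ [_ _ [C fC]]; split.
  by exists `|f 0|, 0 => //; split=> //; rewrite seminorm0.
exists `|C| => _ [a [Sa pa] <-]; apply: (le_trans (fC _ Sa)).
have := seminorm_ge0 Sa; have := ler_norm C; have := normr_ge0 C; nra.
Qed.

Lemma dual_norm_ge0 f : dual_dom S p f -> 0 <= dual_norm S p f.
Proof.
move=> fd; apply: (le_trans (normr_ge0 (f 0))).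
apply: sup_upper_bound; first exact: dual_norm_has_sup.
by exists 0 => //; split; [case: Ssub|rewrite seminorm0].
Qed.

Lemma dual_norm_bound f a : dual_dom S p f -> S a -> `|f a| <= dual_norm S p f * p a.
Proof.
move=> fd Sa; have [_ _ SZ] := Ssub; have [_ fZ [C fC]] := fd.
(* A vector with [p a = 0] cannot be normalised, but there the bound [C * p a] forces [f a = 0]. *)
have := seminorm_ge0 Sa; rewrite le_eqVlt => /predU1P[p0|p0].
  by have := fC _ Sa; rewrite -p0 !mulr0.
rewrite -ler_pdivrMr// mulrC -[(p a)^-1]gtr0_norm ?invr_gt0// -normrM -fZ//.
apply: sup_upper_bound; first exact: dual_norm_has_sup.
exists ((p a)^-1 *: a) => //; split; first exact: SZ.
by rewrite pS.2// gtr0_norm ?invr_gt0// mulVf// gt_eqF.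
Qed.

Lemma dual_norm_le f C : 0 <= C -> (forall a, S a -> `|f a| <= C * p a) ->
  dual_norm S p f <= C.
Proof.
move=> C0 fC; apply: ge_sup.
  by exists `|f 0|, 0 => //; split; [case: Ssub|rewrite seminorm0].
by move=> _ [a [Sa pa] <-]; rewrite (le_trans (fC _ Sa))// ler_piMr.
Qed.

Lemma dual_dom_subspace : subspace_of (dual_dom S p).
Proof.
split.
- split=> [a b _ _|k a _|]; rewrite ?addr0 ?mulr0//.
  by exists 0 => a _; rewrite normr0 mul0r.
- move=> f g [fD fZ [C fC]] [gD gZ [D gD']]; split=> [a b Sa Sb|k a Sa|].
  + change (f (a + b) + g (a + b) = f a + g a + (f b + g b)).
    by rewrite fD// gD// addrACA.
  + change (f (k *: a) + g (k *: a) = k * (f a + g a)).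
    by rewrite fZ// gZ// mulrDr.
  + exists (C + D) => a Sa; change (`|f a + g a| <= (C + D) * p a).
    by rewrite (le_trans (ler_normD _ _))// mulrDl lerD ?fC ?gD'.
- move=> l f [fD fZ [C fC]]; split=> [a b Sa Sb|k a Sa|].
  + by change (l * f (a + b) = l * f a + l * f b); rewrite fD// mulrDr.
  + by change (l * f (k *: a) = k * (l * f a)); rewrite fZ// mulrCA.
  + exists (`|l| * C) => a Sa; change (`|l * f a| <= `|l| * C * p a).
    by rewrite normrM -mulrA ler_wpM2l ?fC.
Qed.

End DualSeminorm.

Lemma dual_norm_seminorm (R : realType) (V : lmodType R) (S : set V) (p : V -> R) :
  subspace_of S -> seminorm_on S p -> seminorm_on (dual_dom S p) (dual_norm S p).
Proof.
move=> Ssub pS; have [_ DD DZ] := dual_dom_subspace S p.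
split=> [f g fd gd|k f fd].
  apply: dual_norm_le => // [|a Sa]; first by rewrite addr_ge0// dual_norm_ge0.
  change (`|f a + g a| <= (dual_norm S p f + dual_norm S p g) * p a).
  by rewrite (le_trans (ler_normD _ _))// mulrDl lerD// dual_norm_bound.
have le_norm l g : dual_dom S p g -> dual_norm S p (l *: g) <= `|l| * dual_norm S p g.
  move=> gd; apply: dual_norm_le => // [|a Sa]; first by rewrite mulr_ge0// dual_norm_ge0.
  change (`|l * g a| <= `|l| * dual_norm S p g * p a).
  by rewrite normrM -mulrA ler_wpM2l// dual_norm_bound.
apply/eqP; rewrite eq_le le_norm//=.
have [->|k0] := eqVneq k 0.
  by rewrite normr0 mul0r; apply: dual_norm_ge0 => //; exact: DZ.
have := le_norm k^-1 (k *: f) (DZ _ _ fd).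
by rewrite scalerA mulVf// scale1r normfV ler_pdivlMl ?normr_gt0.
Qed.

(** * Norms on the dual and the bidual of a normed space *)

Section BidualNorm.
Variables (R : realType) (X : normedModType R).

Lemma sp_dom_subspace : subspace_of (@sp_dom R X).
Proof. by []. Qed.

Lemma sp_norm_seminorm : seminorm_on (@sp_dom R X) (@sp_norm R X).
Proof. by split=> [a b _ _|k a _]; rewrite /sp_norm ?ler_normD ?normrZ. Qed.

Lemma dual1_dom_subspace : subspace_of (@dual1_dom R X).
Proof. exact: dual_dom_subspace. Qed.

Lemma dual1_norm_seminorm : seminorm_on (@dual1_dom R X) (@dual1_norm R X).
Proof. exact: dual_norm_seminorm sp_dom_subspace sp_norm_seminorm. Qed.

Lemma dual1_norm_bound f x : dual1_dom f -> `|f x| <= @dual1_norm R X f * `|x|.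
Proof. by move=> fd; exact: (dual_norm_bound sp_dom_subspace sp_norm_seminorm fd). Qed.

Lemma dual1_norm_le (f : X -> R) C : 0 <= C -> (forall x, `|f x| <= C * `|x|) ->
  dual1_norm f <= C.
Proof.
by move=> C0 fC; apply: (dual_norm_le sp_dom_subspace sp_norm_seminorm) => // a _.
Qed.

Lemma bidual_dom_subspace : subspace_of (@bidual_dom R X).
Proof. exact: dual_dom_subspace. Qed.

Lemma bidual_norm_seminorm : seminorm_on (@bidual_dom R X) (@bidual_norm R X).
Proof. exact: dual_norm_seminorm dual1_dom_subspace dual1_norm_seminorm. Qed.

Lemma bidual_norm_bound phi f : bidual_dom phi -> dual1_dom f ->
  `|phi f| <= @bidual_norm R X phi * dual1_norm f.
Proof. exact: dual_norm_bound dual1_dom_subspace dual1_norm_seminorm _ _. Qed.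

Lemma bidual_norm_le phi C : 0 <= C ->
  (forall f, dual1_dom f -> `|phi f| <= C * dual1_norm f) ->
  @bidual_norm R X phi <= C.
Proof. exact: (dual_norm_le dual1_dom_subspace dual1_norm_seminorm). Qed.

Lemma bidual_norm_ge0 phi : bidual_dom phi -> 0 <= @bidual_norm R X phi.
Proof. exact: (seminorm_ge0 bidual_dom_subspace bidual_norm_seminorm). Qed.

Lemma canon_bidual (x : X) : bidual_dom (Defs.canon x).
Proof.
split=> //; exists `|x| => f fd.
by rewrite mulrC; exact: dual1_norm_bound.
Qed.

End BidualNorm.

(** * Biduals *)

Section Coupling.
Variables (R : realType).

(* [N x y] stands for [|U x - U' y|], where [U] and [U'] embed [X] and [Y] in a
   common space in which the two unit balls are at Hausdorff distance [<= d]. *)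
Definition coupling (X Y : normedModType R) (N : X -> Y -> R) (d : R) : Prop :=
  [/\ (forall x y x' y', N (x + x') (y + y') <= N x y + N x' y') /\
      (forall k x y, N (k *: x) (k *: y) = `|k| * N x y),
      (forall x, N x 0 = `|x|) /\ (forall y, N 0 y = `|y|),
      (forall x, exists2 y, `|y| <= `|x| & N x y <= d * `|x|),
      (forall y, exists2 x, `|x| <= `|y| & N x y <= d * `|y|) &
      0 < d].

Definition swap (X Y : Type) (N : X -> Y -> R) : Y -> X -> R := fun y x => N x y.

(** This symmetry halves the later work: each statement about [X] transfers to [Y]. *)
Lemma coupling_swap (X Y : normedModType R) (N : X -> Y -> R) d :
  coupling N d -> coupling (swap N) d.
Proof.
by move=> [[ND NZ] [NX NY] NXY NYX d0]; split=> //; split=> *; [exact: ND|exact: NZ].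
Qed.

(** Strictness yields embeddings whose balls are at Hausdorff distance below [d]. Nonzero vectors
    are normalised, approximated in the ball and scaled back; [d] is positive because a norm lies
    strictly below it. *)
Lemma coupling_of_kadets_dist (X Y : normedModType R) (d : R) :
  (kadets_dist (@sp_dom R X) (@sp_norm R X) (@sp_dom R Y) (@sp_norm R Y) < d%:E)%E ->
  exists N : X -> Y -> R, coupling N d.
Proof.
move=> /ereal_inf_lt [_ [Z [U [U' [[UD UZ UN] [UD' UZ' UN'] ->]]]]].
rewrite /hausdorff_dist gt_max => /andP[HX HY].
have ballX x : `|x| <= 1 -> exists2 y, `|y| <= 1 & `|U x - U' y| < d.
  move=> x1; have : (dist_to_set (U x) (U' @` unit_ball (@sp_dom R Y) (@sp_norm R Y)) < d%:E)%E.
    apply: le_lt_trans HX; apply: ereal_sup_ubound.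
    by exists (U x) => //; exists x => //; split.
  by move=> /ereal_inf_lt [_ [_ [y [_ y1] <-] <-]]; rewrite lte_fin; exists y.
have ballY y : `|y| <= 1 -> exists2 x, `|x| <= 1 & `|U x - U' y| < d.
  move=> y1; have : (dist_to_set (U' y) (U @` unit_ball (@sp_dom R X) (@sp_norm R X)) < d%:E)%E.
    apply: le_lt_trans HY; apply: ereal_sup_ubound.
    by exists (U' y) => //; exists y => //; split.
  by move=> /ereal_inf_lt [_ [_ [x [_ x1] <-] <-]]; rewrite lte_fin distrC; exists x.
have U0 : U 0 = 0 by rewrite -(scale0r 0) UZ// scale0r.
have U'0 : U' 0 = 0 by rewrite -(scale0r 0) UZ'// scale0r.
have NZ k x y : `|U (k *: x) - U' (k *: y)| = `|k| * `|U x - U' y|.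
  by rewrite UZ// UZ'// -scalerBr normrZ.
have d0 : 0 < d.
  have [|y _] := ballX 0; first by rewrite normr0.
  exact: le_lt_trans.
exists (fun x y => `|U x - U' y|); split=> //.
- split=> // x y x' y'; rewrite UD// UD'// opprD addrACA; exact: ler_normD.
- by split=> [x|y]; [rewrite U'0 subr0 UN|rewrite U0 sub0r normrN UN'].
- move=> x; have [->|x0] := eqVneq x 0.
    by exists 0; rewrite /= ?U0 ?U'0 ?subr0 !normr0 ?mulr0.
  have [|y y1 yd] := ballX (`|x|^-1 *: x); first by rewrite normfZV.
  exists (`|x| *: y); first by rewrite normrZ normr_id ler_piMr.
  have -> : U x = U (`|x| *: (`|x|^-1 *: x)) by rewrite scalerA mulfV ?normr_eq0// scale1r.
  rewrite /= NZ normr_id mulrC.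
  by rewrite ler_wpM2r// ltW.
- move=> y; have [->|y0] := eqVneq y 0.
    by exists 0; rewrite /= ?U0 ?U'0 ?subr0 !normr0 ?mulr0.
  have [|x x1 xd] := ballY (`|y|^-1 *: y); first by rewrite normfZV.
  exists (`|y| *: x); first by rewrite normrZ normr_id ler_piMr.
  have -> : U' y = U' (`|y| *: (`|y|^-1 *: y)) by rewrite scalerA mulfV ?normr_eq0// scale1r.
  rewrite /= NZ normr_id mulrC.
  by rewrite ler_wpM2r// ltW.
Qed.

End Coupling.

(** * The bidual of a coupling *)

Section BidualCoupling.
Variables (R : realType) (X Y : normedModType R) (N : X -> Y -> R).

(* [(f, g)] is the restriction to [X] and [Y] of a functional of norm [<= C]. *)
Definition compat (C : R) (f : X -> R) (g : Y -> R) : Prop :=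
  [/\ dual1_dom f, dual1_dom g & forall x y, `|f x - g y| <= C * N x y].

(* The epigraph of the bidual of the seminorm [N]. *)
Definition bicone (phi : (X -> R) -> R) (psi : (Y -> R) -> R) (r : R) : Prop :=
  [/\ bidual_dom phi, bidual_dom psi &
      forall f g, compat 1 f g -> `|phi f - psi g| <= r].

End BidualCoupling.

Section BidualCouplingTheory.
Variables (R : realType) (X Y : normedModType R) (N : X -> Y -> R) (d : R).
Hypothesis Nc : coupling N d.

Lemma compatN C f g : compat N C f g -> compat N C (- f) (- g).
Proof.
move=> [fd gd fg]; have [_ _ XZ] := dual1_dom_subspace X.
have [_ _ YZ] := dual1_dom_subspace Y; split.
- by rewrite -scaleN1r; exact: XZ.
- by rewrite -scaleN1r; exact: YZ.
- move=> x y; change (`|- f x - - g y| <= C * N x y).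
  by rewrite -opprD normrN.
Qed.

Lemma dual1_dom_of_bound (Z : normedModType R) (f : Z -> R) C :
  linear_on (@sp_dom R Z) f -> (forall x, `|f x| <= C * `|x|) -> dual1_dom f.
Proof. by move=> [fD fZ] fC; split => //; exists C. Qed.

(** This is norm-preserving extension of [f] from [X] to the common space, read on [Y]: [g] is a
    linear functional below the infimum over [x] of [N x (- y) - f x]. Over [y = 0] these heights
    are [|x| - f x], hence nonnegative. *)
Lemma compat_extend f : dual1_dom f -> (forall x, `|f x| <= `|x|) ->
  exists g, compat N 1 f g.
Proof.
move=> fd f1; have [[ND NZ] [NX NY] _ _ _] := Nc; have [fD fZ _] := fd.
have f0 : f 0 = 0 by rewrite -(scale0r 0) fZ// mul0r.
pose C : set (Y * R) := [set z | exists x, N x (- z.1) - f x <= z.2].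
have [|||g gl gC] := @hahn_banach_cone R Y setT C.
- by [].
- split=> // [|r [x /=]]; first split.
  + by exists 0; rewrite /= oppr0 NX normr0 f0 subrr.
  + move=> y y' r s [x /= h] [x' /= h']; exists (x + x'); rewrite /= fD// opprD.
    by have := ND x (- y) x' (- y'); lra.
  + move=> k y r k0 [x /= h]; exists (k *: x).
    by rewrite /= -scalerN NZ fZ// gtr0_norm// -mulrBr ler_pM2l.
  + by rewrite oppr0 NX; have := f1 x; rewrite ler_norml => /andP[_]; lra.
- by move=> y _; exists (N 0 (- y) - f 0), 0.
have gle x y : f x - g y <= N x y.
  have := gC (- y) (N x y - f x); rewrite (linear_onN gl)// => /(_ _)/=.
  have h : C (- y, N x y - f x) by exists x; rewrite /= opprK.
  by move=> /(_ h); lra.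
have gabs x y : `|f x - g y| <= N x y.
  rewrite ler_norml gle andbT lerNl.
  have := gle (- x) (- y); rewrite (linear_onN gl)// -scaleN1r fZ//.
  have -> : N (-1 *: x) (- y) = N x y by rewrite -[- y]scaleN1r NZ normrN1 mul1r.
  by lra.
exists g; split => //.
- apply: (@dual1_dom_of_bound _ _ 1) => // y.
  by have := gabs 0 y; rewrite f0 sub0r normrN NY mul1r.
- by move=> x y; rewrite mul1r.
Qed.

Lemma compat1_dual1_norm f g : compat N 1 f g -> dual1_norm f <= 1.
Proof.
move=> [_ gd fg]; have [_ [NX _] _ _ _] := Nc.
apply: dual1_norm_le => // x; have := fg x 0.
by rewrite (linear_on0 (sp_dom_subspace Y) (dual_dom_linear gd)) subr0 NX.
Qed.

Lemma bicone_left phi : bidual_dom phi -> bicone N phi 0 (bidual_norm phi).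
Proof.
move=> pd; split=> //; first by have [] := bidual_dom_subspace Y.
move=> f g fg; have [fd _ _] := fg.
rewrite [X in `|_ - X|](_ : _ = 0)// subr0 (le_trans (bidual_norm_bound pd fd))//.
by rewrite ler_piMr ?bidual_norm_ge0//; exact: compat1_dual1_norm fg.
Qed.

(** Every functional in the dual ball of [X] is half of a compatible pair, so testing on such pairs
    recovers the whole bidual norm. *)
Lemma bicone_left_le phi r : bicone N phi 0 r -> bidual_norm phi <= r.
Proof.
move=> [pd _ pr]; apply: ge_sup.
  exists `|phi 0|, 0 => //; split; first by have [] := dual1_dom_subspace X.
  by rewrite (seminorm0 (dual1_dom_subspace X) (dual1_norm_seminorm X)).
move=> _ [f [fd f1] <-]; have [|g fg] := compat_extend fd.
  move=> x; apply: le_trans (dual1_norm_bound x fd) _.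
  by rewrite ler_piMl.
have := pr _ _ fg; rewrite [X in `|_ - X|](_ : _ = 0)// subr0; exact.
Qed.

(* The Hahn-Banach theorem on the dual of [Y] replaces the usual detour through
   Goldstine's theorem and weak-star compactness: the bound on [psi] and the
   bound on [phi f - psi g] together say that [psi] is dominated by the
   infimal convolution of their right-hand sides. *)
Lemma bicone_transfer phi : bidual_dom phi ->
  exists2 psi, bidual_norm psi <= bidual_norm phi &
               bicone N phi psi (d * bidual_norm phi).
Proof.
move=> pd; have [_ _ NXY _ d0] := Nc; set c := bidual_norm phi.
have c0 : 0 <= c by exact: bidual_norm_ge0.
have [pD pZ _] := pd.
have p0 := linear_on0 (dual1_dom_subspace X) (dual_dom_linear pd).
have X0 : dual1_dom (0 : X -> R) by have [] := dual1_dom_subspace X.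
have Y0 : dual1_dom (0 : Y -> R) by have [] := dual1_dom_subspace Y.
(* Write [h = (h - g) + g]. A [psi] as sought satisfies [psi (h - g) <= c * a] and
   [psi g <= phi f + d * c * C]; the heights are the sums of these two bounds. *)
pose K : set ((Y -> R) * R) := [set z | dual1_dom z.1 /\ exists f g a C,
  [/\ compat N C f g, 0 <= a, 0 <= C, (forall y, `|z.1 y - g y| <= a * `|y|) &
     c * (a + d * C) + phi f <= z.2]].
have compat0 : compat N 0 0 0.
  by split=> // x y; rewrite subrr normr0 mul0r.
have K1 h a : dual1_dom h -> 0 <= a -> (forall y, `|h y| <= a * `|y|) -> K (h, c * a).
  move=> hd a0 ha; split=> //; exists 0, 0, a, 0; split=> //=.
    by move=> y; rewrite [X in `|_ - X|](_ : _ = 0)// subr0.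
  by rewrite p0 mulr0 !addr0.
have [|||psi psil psiK] := @hahn_banach_cone R (Y -> R) (@dual1_dom R Y) K.
- exact: dual1_dom_subspace.
- split; first split.
  + by have := K1 0 0 Y0 (lexx _); rewrite mulr0; apply=> y; rewrite normr0 mul0r.
  + move=> h h' r r' [/= hd [f [g [a [C [[fd gd fg] a0 C0 hg Kr]]]]]].
    move=> [/= h'd [f' [g' [a' [C' [[f'd g'd fg'] a'0 C'0 hg' Kr']]]]]].
    have [_ XD _] := dual1_dom_subspace X; have [_ YD _] := dual1_dom_subspace Y.
    split; first exact: YD.
    exists (f + f'), (g + g'), (a + a'), (C + C'); split=> /=; rewrite ?addr_ge0//.
    * split; [exact: XD|exact: YD|move=> x y].
      change (`|f x + f' x - (g y + g' y)| <= (C + C') * N x y).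
      by rewrite opprD addrACA mulrDl (le_trans (ler_normD _ _))// lerD.
    * move=> y; change (`|h y + h' y - (g y + g' y)| <= (a + a') * `|y|).
      by rewrite opprD addrACA mulrDl (le_trans (ler_normD _ _))// lerD.
    * by rewrite pD//; lra.
  + move=> k h r k0 [/= hd [f [g [a [C [[fd gd fg] a0 C0 hg Kr]]]]]].
    have [_ _ XZ] := dual1_dom_subspace X; have [_ _ YZ] := dual1_dom_subspace Y.
    have k0' := ltW k0; split; first exact: YZ.
    exists (k *: f), (k *: g), (k * a), (k * C); split=> /=; rewrite ?mulr_ge0//.
    * split; [exact: XZ|exact: YZ|move=> x y].
      change (`|k * f x - k * g y| <= k * C * N x y).
      by rewrite -mulrBr normrM gtr0_norm// -mulrA ler_pM2l.
    * move=> y; change (`|k * h y - k * g y| <= k * a * `|y|).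
      by rewrite -mulrBr normrM gtr0_norm// -mulrA ler_pM2l.
    * rewrite pZ//; have -> : c * (k * a + d * (k * C)) + k * phi f =
          k * (c * (a + d * C) + phi f) by ring.
      by rewrite ler_pM2l.
  + by move=> h r [].
  + move=> r [_ [f [g [a [C [[fd gd fg] a0 C0 /= hg Kr]]]]]].
    have ad0 : 0 <= a + d * C by rewrite addr_ge0// mulr_ge0// ltW.
    (* Over [h = 0] the functional [g] has norm at most [a]. Comparing [f x] with [g y] for a [y]
       close to [x] bounds [f], and hence [phi f]. *)
    have fle x : `|f x| <= (a + d * C) * `|x|.
      have [y yx Nxy] := NXY x.
      have h1 : `|g y| <= a * `|y| by have := hg y; rewrite sub0r normrN.
      have h2 : `|f x| <= `|f x - g y| + `|g y|.
        by rewrite -[in leLHS](subrK (g y) (f x)) ler_normD.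
      have := fg x y; nra.
    have : `|phi f| <= c * (a + d * C).
      apply: (le_trans (bidual_norm_bound pd fd)).
      by rewrite ler_wpM2l//; exact: dual1_norm_le.
    by rewrite ler_norml => /andP[]; lra.
- move=> h hd; exists (c * dual1_norm h); apply: K1 => //.
    exact: (seminorm_ge0 (dual1_dom_subspace Y) (dual1_norm_seminorm Y)).
  by move=> y; exact: dual1_norm_bound.
have psi_le h : dual1_dom h -> psi h <= c * dual1_norm h.
  move=> hd; apply/psiK/K1 => //.
    exact: (seminorm_ge0 (dual1_dom_subspace Y) (dual1_norm_seminorm Y)).
  by move=> y; exact: dual1_norm_bound.
have psi_abs h : dual1_dom h -> `|psi h| <= c * dual1_norm h.
  move=> hd; rewrite ler_norml psi_le// andbT lerNl -(linear_onN psil hd).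
  rewrite -(seminorm_opp (dual1_norm_seminorm Y) hd); apply: psi_le.
  by have [_ _ YZ] := dual1_dom_subspace Y; rewrite -scaleN1r; exact: YZ.
have psid : bidual_dom psi by case: psil => ? ?; split=> //; exists c.
exists psi; first exact: bidual_norm_le.
(* Here [h = g], [a = 0] and [C = 1]; the opposite bound follows by negating the pair. *)
have psi_sub f g : compat N 1 f g -> psi g - phi f <= d * c.
  move=> fg; have [fd gd _] := fg.
  have : psi g <= c * (0 + d * 1) + phi f.
    apply: psiK; split=> //; exists f, g, 0, 1; split=> //= y.
    by rewrite subrr normr0 mul0r.
  by lra.
split=> // f g fg; have [fd gd _] := fg.
rewrite distrC ler_norml psi_sub// andbT.
have := psi_sub _ _ (compatN fg).
by rewrite (linear_onN psil gd) (linear_onN (dual_dom_linear pd) fd); lra.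
Qed.

End BidualCouplingTheory.

Section BiconeCone.
Variables (R : realType) (X Y : normedModType R) (N : X -> Y -> R).

Lemma bicone_swap phi psi r : bicone N phi psi r -> bicone (swap N) psi phi r.
Proof.
move=> [pd sd h]; split=> // g f [gd fd fg]; rewrite distrC; apply: h.
by split=> // x y; rewrite distrC; exact: fg.
Qed.

Lemma biconeD phi psi r phi' psi' r' : bicone N phi psi r -> bicone N phi' psi' r' ->
  bicone N (phi + phi') (psi + psi') (r + r').
Proof.
move=> [pd sd h] [pd' sd' h']; have [_ XD _] := bidual_dom_subspace X.
have [_ YD _] := bidual_dom_subspace Y; split; [exact: XD|exact: YD|move=> f g fg].
change (`|phi f + phi' f - (psi g + psi' g)| <= r + r').
by rewrite opprD addrACA (le_trans (ler_normD _ _))// lerD ?h ?h'.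
Qed.

Lemma biconeZ k phi psi r : bicone N phi psi r ->
  bicone N (k *: phi) (k *: psi) (`|k| * r).
Proof.
move=> [pd sd h]; have [_ _ XZ] := bidual_dom_subspace X.
have [_ _ YZ] := bidual_dom_subspace Y; split; [exact: XZ|exact: YZ|move=> f g fg].
change (`|k * phi f - k * psi g| <= `|k| * r).
by rewrite -mulrBr normrM ler_wpM2l// h.
Qed.

Lemma biconeN phi psi r : bicone N phi psi r -> bicone N (- phi) (- psi) r.
Proof. by move=> /(biconeZ (-1)); rewrite normrN1 mul1r !scaleN1r. Qed.

Lemma bicone_le phi psi r s : r <= s -> bicone N phi psi r -> bicone N phi psi s.
Proof. by move=> rs [pd sd h]; split=> // f g /h /le_trans; exact. Qed.

End BiconeCone.

Lemma bicone_right (R : realType) (X Y : normedModType R) (N : X -> Y -> R) d psi :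
  coupling N d -> bidual_dom psi -> bicone N 0 psi (bidual_norm psi).
Proof. by move=> /coupling_swap Nc /(bicone_left Nc)/bicone_swap. Qed.

Lemma bicone_right_le (R : realType) (X Y : normedModType R) (N : X -> Y -> R) d psi r :
  coupling N d -> bicone N 0 psi r -> bidual_norm psi <= r.
Proof. by move=> /coupling_swap Nc /bicone_swap /(bicone_left_le Nc). Qed.

Theorem kadets_dist_bidual_le (R : realType) (X Y : normedModType R) (N : X -> Y -> R) d :
  coupling N d ->
  (kadets_dist (@bidual_dom R X) (@bidual_norm R X)
               (@bidual_dom R Y) (@bidual_norm R Y) <= d%:E)%E.
Proof.
move=> Nc; have [_ _ _ _ d0] := Nc.
apply: (@kadets_dist_le_gluing _ _ _ _ _ _ _ [set z | bicone N z.1.1 z.1.2 z.2]).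
- exact: bidual_dom_subspace.
- exact: bidual_dom_subspace.
- split=> [|phi psi r []//|phi psi r|phi pd|psi sd].
  + split=> [|[phi psi] [phi' psi'] r r'|k [phi psi] r k0] /=.
    * have [X0 _ _] := bidual_dom_subspace X.
      have := bicone_left Nc X0.
      by rewrite (seminorm0 (bidual_dom_subspace X) (bidual_norm_seminorm X)).
    * exact: biconeD.
    * by move=> /(biconeZ k); rewrite gtr0_norm.
  + exact: biconeN.
  + split=> [r /(bicone_left_le Nc)//|r /ltW pr].
    exact: (bicone_le pr (bicone_left Nc pd)).
  + split=> [r /(bicone_right_le Nc)//|r /ltW pr].
    exact: (bicone_le pr (bicone_right Nc sd)).
- move=> phi [pd p1]; have [psi psi1 h] := bicone_transfer Nc pd.
  exists psi; first by split; [case: h|exact: le_trans p1].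
  move=> s ds; apply: bicone_le h; rewrite (le_trans _ (ltW ds))//.
  by rewrite ler_piMr// ltW.
- move=> psi [sd s1]; have [phi phi1 h] := bicone_transfer (coupling_swap Nc) sd.
  exists phi; first by split; [case: h|exact: le_trans s1].
  move=> s ds; apply: (bicone_le _ (bicone_swap h)); rewrite (le_trans _ (ltW ds))//.
  by rewrite ler_piMr// ltW.
Qed.

(** * Ultrapowers *)

Section Ultrapower.
Variables (R : realType) (X : normedModType R) (U : set_system nat).
Hypothesis UU : UltraFilter U.

Lemma linfty_dom_subspace : subspace_of (@linfty_dom R X).
Proof.
split=> [|x y [M xM] [M' yM']|k x [M xM]].
- by exists 0 => n; rewrite normr0.
- exists (M + M') => n; change (`|x n + y n| <= M + M').
  by rewrite (le_trans (ler_normD _ _))// lerD.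
- by exists (`|k| * M) => n; change (`|k *: x n| <= `|k| * M); rewrite normrZ ler_wpM2l.
Qed.

(** The image of [U] under the norms is an ultrafilter containing the compact interval from [0] to
    [M], hence converges. So on bounded sequences the [lim] in [ultra_norm] is a genuine limit, not
    a default value. *)
Lemma cvg_ultra_norm (x : nat -> X) : linfty_dom x ->
  `|x n| @[n --> U] --> ultra_norm U x.
Proof.
move=> [M xM]; pose F := (fun n => `|x n|) @ U.
have FU : UltraFilter F.
  split=> [|G GF FG]; first exact: fmap_proper_filter.
  apply/seteqP; split=> // A GA.
  have [//|FA] := in_ultra_setVsetC ((fun n => `|x n|) @^-1` A) UU.
  have : G (A `&` ~` A) by apply: filterI => //; exact: FG.
  by rewrite setICr => /filter_not_empty.
have : compact `[0, M]%classic by exact: segment_compact.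
rewrite compact_ultra => /(_ F FU) [|l [_ Fl]].
  by apply: (@filterE _ U) => n /=; rewrite in_itv /= normr_ge0 xM.
have -> : ultra_norm U x = l by exact: cvg_lim.
exact: Fl.
Qed.

Lemma ultra_norm_near_le (x : nat -> X) r : linfty_dom x -> ultra_norm U x < r ->
  \forall n \near U, `|x n| <= r.
Proof. by move=> /cvg_ultra_norm/cvgr_le; apply. Qed.

Lemma ultra_norm_le (x : nat -> X) r : linfty_dom x ->
  (\forall n \near U, `|x n| <= r) -> ultra_norm U x <= r.
Proof. by move=> /cvg_ultra_norm; exact: cvgr_to_le. Qed.

End Ultrapower.

Theorem kadets_dist_ultrapower_le (R : realType) (X Y : normedModType R)
    (N : X -> Y -> R) d (U : set_system nat) :
  UltraFilter U -> coupling N d ->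
  (kadets_dist (@linfty_dom R X) (@ultra_norm R X U)
               (@linfty_dom R Y) (@ultra_norm R Y U) <= d%:E)%E.
Proof.
move=> UU [[ND NZ] [NX NY] NXY NYX d0].
pose K : set ((nat -> X) * (nat -> Y) * R) :=
  [set z | [/\ linfty_dom z.1.1, linfty_dom z.1.2 &
               \forall n \near U, N (z.1.1 n) (z.1.2 n) <= z.2]].
have [X0 XD XZ] := linfty_dom_subspace X; have [Y0 YD YZ] := linfty_dom_subspace Y.
have KZ k x y r : K (x, y, r) -> K (k *: x, k *: y, `|k| * r).
  move=> [xd yd h]; split; [exact: XZ|exact: YZ|apply: filterS h => n h].
  by change (N (k *: x n) (k *: y n) <= `|k| * r); rewrite NZ ler_wpM2l.
have N00 : N 0 0 = 0 by rewrite NX normr0.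
(* A sequence in the ultrapower ball may have terms of norm above [1], but along [U] the norms are
   eventually at most [s / d], since [s / d > 1]. *)
have ball_near (Z : normedModType R) (z : nat -> Z) s :
    unit_ball (@linfty_dom R Z) (ultra_norm U) z -> d < s ->
    \forall n \near U, d * `|z n| <= s.
  move=> [zd z1] ds; have : ultra_norm U z < s / d.
    by rewrite (le_lt_trans z1)// ltr_pdivlMr// mul1r.
  move=> /(ultra_norm_near_le UU zd); apply: filterS => n.
  by rewrite ler_pdivlMr// mulrC.
apply: (@kadets_dist_le_gluing _ _ _ _ _ _ _ K).
- exact: linfty_dom_subspace.
- exact: linfty_dom_subspace.
- split=> [|x y r []//|x y r Kxy|x xd|y yd].
  + split=> [|[x y] [x' y'] r r' [xd yd h] [x'd y'd h']|k [x y] r k0 Kxy].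
    * by split=> //; apply: filterE => n /=; rewrite N00.
    * split; [exact: XD|exact: YD|apply: filterS2 h h' => n h h'].
      change (N (x n + x' n) (y n + y' n) <= r + r').
      by rewrite (le_trans (ND _ _ _ _))// lerD.
    * by have := KZ k _ _ _ Kxy; rewrite gtr0_norm.
  + by have := KZ (-1) _ _ _ Kxy; rewrite !scaleN1r normrN1 mul1r.
  + split=> r; first move=> [_ _ h].
      by apply: ultra_norm_le => //; apply: filterS h => n; rewrite NX.
    move=> /(ultra_norm_near_le UU xd) h; split=> //; apply: filterS h => n /=.
    by rewrite NX.
  + split=> r; first move=> [_ _ h].
      by apply: ultra_norm_le => //; apply: filterS h => n; rewrite NY.
    move=> /(ultra_norm_near_le UU yd) h; split=> //; apply: filterS h => n /=.
    by rewrite NY.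
- move=> x /[dup] xB [xd x1].
  (* Approximating term by term with [|y n| <= |x n|] keeps [y] bounded and its limit norm at most
     [1]. *)
  have [y yP] := choice (fun n => let: ex_intro2 y h1 h2 := NXY (x n) in
    ex_intro (fun y => `|y| <= `|x n| /\ N (x n) y <= d * `|x n|) y (conj h1 h2)).
  have yd : linfty_dom y.
    by have [M xM] := xd; exists M => n; rewrite (le_trans _ (xM n))//; case: (yP n).
  exists y => [|s ds].
    split=> //; apply/ler_addgt0Pr => e e0; apply: ultra_norm_le => //.
    have : ultra_norm U x < 1 + e by rewrite (le_lt_trans x1)// ltrDl.
    move=> /(ultra_norm_near_le UU xd); apply: filterS => n /=.
    by apply: le_trans; case: (yP n).
  split=> //; apply: filterS (ball_near _ _ _ xB ds) => n /=.
  by apply: le_trans; case: (yP n).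
- move=> y /[dup] yB [yd y1].
  have [x xP] := choice (fun n => let: ex_intro2 x h1 h2 := NYX (y n) in
    ex_intro (fun x => `|x| <= `|y n| /\ N x (y n) <= d * `|y n|) x (conj h1 h2)).
  have xd : linfty_dom x.
    by have [M yM] := yd; exists M => n; rewrite (le_trans _ (yM n))//; case: (xP n).
  exists x => [|s ds].
    split=> //; apply/ler_addgt0Pr => e e0; apply: ultra_norm_le => //.
    have : ultra_norm U y < 1 + e by rewrite (le_lt_trans y1)// ltrDl.
    move=> /(ultra_norm_near_le UU yd); apply: filterS => n /=.
    by apply: le_trans; case: (xP n).
  split=> //; apply: filterS (ball_near _ _ _ yB ds) => n /=.
  by apply: le_trans; case: (xP n).
Qed.

(** * Quotients of biduals *)

Section BidualQuotient.
Variables (R : realType) (X : normedModType R).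

(* [|phi - canon x| <= s]; [x] ranges over [X] and [canon] is additive only on
   [dual1_dom], which is why the inequality is spelled out pointwise. *)
Definition canon_dist_le (phi : (X -> R) -> R) (x : X) (s : R) : Prop :=
  [/\ bidual_dom phi, 0 <= s &
      forall f, dual1_dom f -> `|phi f - f x| <= s * dual1_norm f].

Lemma bidual_dom_sub_canon phi x : bidual_dom phi -> bidual_dom (phi - @Defs.canon R X x).
Proof.
move=> pd; have [_ XD XZ] := bidual_dom_subspace X; apply: XD => //.
by rewrite -scaleN1r; apply: XZ; exact: canon_bidual.
Qed.

Lemma bidual_quot_norm_le phi x s : canon_dist_le phi x s -> @bidual_quot_norm R X phi <= s.
Proof.
move=> [pd s0 ps]; apply: (@le_trans _ _ (bidual_norm (phi - Defs.canon x))).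
  apply: ge_inf; last by exists x.
  by exists 0 => _ [z _ <-]; apply/bidual_norm_ge0/bidual_dom_sub_canon.
by apply: bidual_norm_le => // f fd; exact: ps.
Qed.

(** The infimum over [X] need not be attained, hence the strict inequality. *)
Lemma bidual_quot_norm_lt phi s : bidual_dom phi -> @bidual_quot_norm R X phi < s ->
  exists x, canon_dist_le phi x s.
Proof.
move=> pd /inf_lt [].
  by eexists; exists 0.
move=> _ [x _ <-] /ltW xs; have pxd := bidual_dom_sub_canon x pd.
exists x; split=> // [|f fd].
  by apply: le_trans xs; exact: bidual_norm_ge0.
apply: (le_trans (bidual_norm_bound pxd fd)); apply: ler_wpM2r => //.
exact: (seminorm_ge0 (dual1_dom_subspace X) (dual1_norm_seminorm X)).
Qed.

Lemma canon_dist_leD phi x s psi y t : canon_dist_le phi x s -> canon_dist_le psi y t ->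
  canon_dist_le (phi + psi) (x + y) (s + t).
Proof.
move=> [pd s0 ps] [qd t0 qt]; have [_ XD _] := bidual_dom_subspace X.
split; [exact: XD|exact: addr_ge0|move=> f fd].
change (`|phi f + psi f - f (x + y)| <= (s + t) * dual1_norm f).
have [fD _ _] := fd; rewrite fD// opprD addrACA mulrDl.
by rewrite (le_trans (ler_normD _ _))// lerD ?ps ?qt.
Qed.

Lemma canon_dist_leZ k phi x s : canon_dist_le phi x s ->
  canon_dist_le (k *: phi) (k *: x) (`|k| * s).
Proof.
move=> [pd s0 ps]; have [_ _ XZ] := bidual_dom_subspace X.
split; [exact: XZ|exact: mulr_ge0|move=> f fd].
change (`|k * phi f - f (k *: x)| <= `|k| * s * dual1_norm f).
by have [_ fZ _] := fd; rewrite fZ// -mulrBr normrM -mulrA ler_wpM2l ?ps.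
Qed.

Lemma canon_dist_le_refl phi : bidual_dom phi -> canon_dist_le phi 0 (bidual_norm phi).
Proof.
move=> pd; split=> // [|f fd]; first exact: bidual_norm_ge0.
rewrite (linear_on0 (sp_dom_subspace X) (dual_dom_linear fd)) subr0.
exact: bidual_norm_bound.
Qed.

Lemma bidual_quot_norm_le_norm phi : @bidual_dom R X phi ->
  @bidual_quot_norm R X phi <= bidual_norm phi.
Proof. by move=> /canon_dist_le_refl; exact: bidual_quot_norm_le. Qed.

(** Hahn-Banach for the epigraph of the norm, with prescribed lower value [|x|] at [x]. *)
Lemma norming_functional (x : X) :
  exists f, [/\ @dual1_dom R X f, dual1_norm f <= 1 & `|x| <= f x].
Proof.
pose C : set (X * R) := [set z | `|z.1| <= z.2].
have [|||//|f [fl fC fx]] := @hahn_banach_cone_at R X setT C x `|x| (sp_dom_subspace X).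
- split=> // [|r]; last by rewrite /C/= normr0.
  split=> [|v w r s|k v r k0]; rewrite /C/=.
  + by rewrite normr0.
  + by move=> vr ws; rewrite (le_trans (ler_normD _ _))// lerD.
  + by rewrite normrZ gtr0_norm// ler_pM2l.
- by move=> w _; exists `|w|; rewrite /C/=.
- by [].
- have f1 y : `|f y| <= 1 * `|y|.
    rewrite mul1r ler_norml (fC y) ?/C//= andbT lerNl -(linear_onN fl)//.
    by rewrite fC// /C/= normrN.
  exists f; split=> //; first exact: dual1_dom_of_bound f1.
  exact: dual1_norm_le.
Qed.

End BidualQuotient.

(** * The gauge on pairs of bidual quotients *)

Section QuotientCone.
Variables (R : realType) (X Y : normedModType R).

(* The gauge generated by the two quotient norms and by the relation
   [|phi1| <= c, |psi1| <= c, |phi1 - psi1| <= d c], the latter at height [3 d c]. *)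
Definition quot_cone (N : X -> Y -> R) (d : R) (phi : (X -> R) -> R)
    (psi : (Y -> R) -> R) (r : R) : Prop :=
  [/\ bidual_dom phi, bidual_dom psi &
    exists phi1 psi1 x y c, exists s t : R,
      [/\ bicone N phi1 psi1 (d * c), bidual_norm phi1 <= c /\ bidual_norm psi1 <= c,
          canon_dist_le (phi - phi1) x s, canon_dist_le (psi - psi1) y t &
          s + t + 3 * d * c <= r]].

End QuotientCone.

Lemma quot_cone_swap (R : realType) (X Y : normedModType R) (N : X -> Y -> R) d phi psi r :
  quot_cone N d phi psi r -> quot_cone (swap N) d psi phi r.
Proof.
move=> [pd sd [phi1 [psi1 [x [y [c [s [t [h [p1 s1] hs ht le]]]]]]]]].
split=> //; exists psi1, phi1, y, x, c, t, s; split=> //; first exact: bicone_swap.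
by rewrite [t + s]addrC.
Qed.

Section QuotientConeTheory.
Variables (R : realType) (X Y : normedModType R) (N : X -> Y -> R) (d : R).
Hypothesis Nc : coupling N d.

Lemma quot_cone_left phi r : bidual_dom phi -> @bidual_quot_norm R X phi < r ->
  quot_cone N d phi 0 r.
Proof.
move=> pd /(bidual_quot_norm_lt pd) [x xr].
have [X0 _ _] := bidual_dom_subspace X; have [Y0 _ _] := bidual_dom_subspace Y.
have n0 (Z : normedModType R) : bidual_norm (0 : (Z -> R) -> R) = 0.
  exact: (seminorm0 (bidual_dom_subspace Z) (bidual_norm_seminorm Z)).
split=> //; exists 0, 0, x, 0, 0, r, 0; split; rewrite ?subr0 ?mulr0 ?addr0 ?n0 //.
- by have := bicone_left Nc X0; rewrite n0.
- by have := canon_dist_le_refl Y0; rewrite n0.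
Qed.

Lemma quot_cone_left_le phi r : quot_cone N d phi 0 r -> bidual_quot_norm phi <= r.
Proof.
move=> [pd _ [phi1 [psi1 [x [y [c [s [t [h [p1 s1] hs ht le_r]]]]]]]]].
have [pd1 sd1 hfg] := h; have [_ _ _ NYX d0] := Nc.
have c0 : 0 <= c by apply: le_trans p1; exact: bidual_norm_ge0.
have dc0 : 0 <= d * c by rewrite mulr_ge0// ltW.
have [_ s0 _] := hs; have [_ t0 tP] := ht.
have phiE : phi = (phi - phi1) + phi1 by rewrite subrK.
(* If [c < t], then approximating [phi1] by [0] costs only [c], which [t] pays for. Otherwise [y] is
   small enough to be transported to [X]. *)
have [ct|tc] := ltP c t.
  apply: (@le_trans _ _ (s + c)); last by lra.
  apply: (@bidual_quot_norm_le _ _ _ (x + 0)); rewrite phiE; apply: canon_dist_leD => //.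
  have [? ? pP] := canon_dist_le_refl pd1; split=> // f fd.
  apply: (le_trans (pP _ fd)); apply: ler_wpM2r => //.
  exact: (seminorm_ge0 (dual1_dom_subspace X) (dual1_norm_seminorm X)).
(* The second component is [0], so [y] approximates [- psi1]; the point near [psi1] is [- y]. *)
have yP g : dual1_dom g -> dual1_norm g <= 1 -> `|psi1 g - g (- y)| <= t.
  move=> gd g1; have [_ gZ _] := gd; have := tP _ gd.
  change (`|0 - psi1 g - g y| <= t * dual1_norm g -> `|psi1 g - g (- y)| <= t).
  rewrite -[- y]scaleN1r gZ// mulN1r -normrN => yt.
  have -> : psi1 g - - g y = - (0 - psi1 g - g y) by ring.
  by rewrite (le_trans yt)// ler_piMr.
have y2c : `|- y| <= 2 * c.
  have [g [gd g1 gy]] := norming_functional (- y); apply: (le_trans gy).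
  have := yP _ gd g1; have := bidual_norm_bound sd1 gd.
  have g0 := seminorm_ge0 (dual1_dom_subspace Y) (dual1_norm_seminorm Y) gd.
  have n0 := bidual_norm_ge0 sd1.
  rewrite !ler_norml => /andP[_ ?] /andP[? ?]; nra.
have [x' _ Nx'y] := NYX (- y).
(* On a compatible pair the path from [phi1 f] through [psi1 g] and [g (- y)] to [f x'] has steps at
   most [d * c], [t] and [2 * d * c]. *)
have hx' : bicone N (phi1 - Defs.canon x') 0 (3 * d * c + t).
  split; [exact: bidual_dom_sub_canon|by have [] := bidual_dom_subspace Y|].
  move=> f g fg; have [fd gd fgN] := fg.
  have g1 : dual1_norm g <= 1.
    apply: (compat1_dual1_norm (coupling_swap Nc) (g := f)).
    by split=> // z w; rewrite distrC; exact: fgN.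
  change (`|phi1 f - f x' - 0| <= 3 * d * c + t).
  have := fgN x' (- y); have := yP _ gd g1; have := hfg _ _ fg.
  rewrite mul1r !ler_norml => /andP[? ?] /andP[? ?] /andP[? ?].
  by apply/andP; split; nra.
have hn := bicone_left_le Nc hx'.
apply: (@le_trans _ _ (s + (3 * d * c + t))); last by lra.
apply: (@bidual_quot_norm_le _ _ _ (x + x')); rewrite phiE; apply: canon_dist_leD => //.
split=> // [|f fd]; first by rewrite addr_ge0//; lra.
apply: le_trans (bidual_norm_bound (bidual_dom_sub_canon x' pd1) fd) _.
apply: ler_wpM2r => //.
exact: (seminorm_ge0 (dual1_dom_subspace X) (dual1_norm_seminorm X)).
Qed.

End QuotientConeTheory.

Section QuotientBound.
Variables (R : realType) (X Y : normedModType R) (N : X -> Y -> R) (d : R).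
Hypothesis Nc : coupling N d.

Lemma quot_cone0 : quot_cone N d 0 0 0.
Proof.
have [X0 _ _] := bidual_dom_subspace X; have [Y0 _ _] := bidual_dom_subspace Y.
have n0 (Z : normedModType R) : bidual_norm (0 : (Z -> R) -> R) = 0.
  exact: (seminorm0 (bidual_dom_subspace Z) (bidual_norm_seminorm Z)).
split=> //; exists 0, 0, 0, 0, 0, 0, 0; split; rewrite ?subr0 ?mulr0 ?addr0 ?n0 //.
- by have := bicone_left Nc X0; rewrite n0.
- by have := canon_dist_le_refl X0; rewrite n0.
- by have := canon_dist_le_refl Y0; rewrite n0.
Qed.

Lemma quot_coneD phi psi r phi' psi' r' :
  quot_cone N d phi psi r -> quot_cone N d phi' psi' r' ->
  quot_cone N d (phi + phi') (psi + psi') (r + r').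
Proof.
move=> [pd sd [p1 [s1 [x [y [c [s [t [h [pc sc] hs ht le_r]]]]]]]]].
move=> [pd' sd' [p1' [s1' [x' [y' [c' [s' [t' [h' [pc' sc'] hs' ht' le_r']]]]]]]]].
have [_ XD _] := bidual_dom_subspace X; have [_ YD _] := bidual_dom_subspace Y.
have [p1d s1d _] := h; have [p1d' s1d' _] := h'.
split; [exact: XD|exact: YD|].
exists (p1 + p1'), (s1 + s1'), (x + x'), (y + y'), (c + c'), (s + s'), (t + t'); split.
- by rewrite mulrDr; exact: biconeD.
- split; first by apply: le_trans (lerD pc pc'); exact: (bidual_norm_seminorm X).1.
  by apply: le_trans (lerD sc sc'); exact: (bidual_norm_seminorm Y).1.
- by rewrite opprD addrACA; exact: canon_dist_leD.
- by rewrite opprD addrACA; exact: canon_dist_leD.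
- by lra.
Qed.

Lemma quot_coneZ k phi psi r : quot_cone N d phi psi r ->
  quot_cone N d (k *: phi) (k *: psi) (`|k| * r).
Proof.
move=> [pd sd [p1 [s1 [x [y [c [s [t [h [pc sc] hs ht le_r]]]]]]]]].
have [_ _ XZ] := bidual_dom_subspace X; have [_ _ YZ] := bidual_dom_subspace Y.
have [p1d s1d _] := h; split; [exact: XZ|exact: YZ|].
exists (k *: p1), (k *: s1), (k *: x), (k *: y), (`|k| * c), (`|k| * s), (`|k| * t).
split.
- by rewrite mulrCA; exact: biconeZ.
- by rewrite (bidual_norm_seminorm X).2// (bidual_norm_seminorm Y).2// !ler_wpM2l.
- by rewrite -scalerBr; exact: canon_dist_leZ.
- by rewrite -scalerBr; exact: canon_dist_leZ.
- by rewrite [3 * d * _]mulrCA -!mulrDr ler_wpM2l.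
Qed.

Lemma quot_cone_ball phi : unit_ball (@bidual_dom R X) (@bidual_quot_norm R X) phi ->
  exists2 psi, unit_ball (@bidual_dom R Y) (@bidual_quot_norm R Y) psi &
               forall s, 8 * d < s -> quot_cone N d phi psi s.
Proof.
(* A representative of norm at most [1 + e] is transferred to [psi1], then scaled by [(1 + e)^-1]
   into the ball at cost [e]. The height is [e + 3 * d * (1 + e)], at most [7 * d] by the choice of
   [e]. *)
move=> [pd pq]; have [_ _ _ _ d0] := Nc; pose e := Num.min 1 d.
have e0 : 0 < e by rewrite lt_min ltr01.
have [e1 ed] : e <= 1 /\ e <= d by rewrite !ge_min !lexx orbT.
have [|x [_ _ px]] := @bidual_quot_norm_lt _ _ phi (1 + e) pd.
  by rewrite (le_lt_trans pq)// ltrDl.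
pose phi1 := phi - Defs.canon x.
have p1d : bidual_dom phi1 by exact: bidual_dom_sub_canon.
have p1e : bidual_norm phi1 <= 1 + e by apply: bidual_norm_le => //; lra.
have [psi1 s1p h] := bicone_transfer Nc p1d; have [_ s1d _] := h.
have s1e := le_trans s1p p1e.
have [_ YD YZ] := bidual_dom_subspace Y.
have i0 : 0 <= (1 + e)^-1 by rewrite invr_ge0; lra.
have ie : (1 + e)^-1 * (1 + e) = 1 by rewrite mulVf// gt_eqF//; lra.
have s1n := bidual_norm_ge0 s1d.
pose psi := (1 + e)^-1 *: psi1; have psid : bidual_dom psi by exact: YZ.
exists psi.
  split=> //; apply: (le_trans (bidual_quot_norm_le_norm psid)).
  rewrite (bidual_norm_seminorm Y).2// ger0_norm// -[leRHS]ie.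
  exact: ler_wpM2l.
move=> s ds; split=> //.
exists phi1, psi1, x, 0, (1 + e), 0, e; split=> //.
- by apply: bicone_le h; rewrite ler_pM2l.
- split=> // [|f fd].
    by rewrite /phi1 opprB addrC subrK; exact: canon_bidual.
  change (`|phi f - (phi f - f x) - f x| <= 0 * dual1_norm f).
  have -> : phi f - (phi f - f x) - f x = 0 by ring.
  by rewrite normr0 mul0r.
- have -> : psi - psi1 = ((1 + e)^-1 - 1) *: psi1 by rewrite scalerBl scale1r.
  have [p_d _ hp] := canon_dist_le_refl (YZ ((1 + e)^-1 - 1) _ s1d).
  split=> // [|g gd]; first exact: ltW.
  apply: (le_trans (hp _ gd)); apply: ler_wpM2r.
    exact: (seminorm_ge0 (dual1_dom_subspace Y) (dual1_norm_seminorm Y)).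
  rewrite (bidual_norm_seminorm Y).2// ler0_norm; nra.
- by nra.
Qed.

End QuotientBound.

Theorem kadets_dist_bidual_quot_le (R : realType) (X Y : normedModType R)
    (N : X -> Y -> R) d :
  coupling N d ->
  (kadets_dist (@bidual_dom R X) (@bidual_quot_norm R X)
               (@bidual_dom R Y) (@bidual_quot_norm R Y) <= (8 * d)%:E)%E.
Proof.
move=> Nc; have Ncs := coupling_swap Nc.
apply: (@kadets_dist_le_gluing _ _ _ _ _ _ _ [set z | quot_cone N d z.1.1 z.1.2 z.2]).
- exact: bidual_dom_subspace.
- exact: bidual_dom_subspace.
- split=> [|phi psi r []//|phi psi r|phi pd|psi sd].
  + split=> [|[phi psi] [phi' psi'] r r'|k [phi psi] r k0] /=.
    * exact: quot_cone0.
    * exact: quot_coneD.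
    * by move=> /(quot_coneZ k); rewrite gtr0_norm.
  + by move=> /(quot_coneZ (-1)); rewrite normrN1 mul1r !scaleN1r.
  + split=> [r /(quot_cone_left_le Nc)//|r]; exact: quot_cone_left.
  + split=> [r /quot_cone_swap/(quot_cone_left_le Ncs)//|r].
    by move=> /(quot_cone_left Ncs sd)/quot_cone_swap.
- exact: quot_cone_ball.
- move=> psi /(quot_cone_ball Ncs) [phi phiB h].
  by exists phi => // s /h/quot_cone_swap.
Qed.

(** * Passage to the infimum *)

Lemma lee_of_lt_fin (R : realType) (a b : \bar R) :
  (forall d : R, (b < d%:E)%E -> (a <= d%:E)%E) -> (a <= b)%E.
Proof.
move=> h; rewrite leNgt; apply/negP => ba.
case: b h ba => [r| |] h ba; last 2 first.
- by move: ba; rewrite ltNge leey.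
(* For [b = -oo] every real number bounds [a]: [s - 1] refutes a finite value [s], and [0] refutes
   [+oo]. *)
- case: a ba h => [s _ /(_ (s - 1) (ltNyr _))|_ /(_ 0 (ltNyr _))|]//.
  by rewrite lee_fin; lra.
move: ba; apply/negP; rewrite -leNgt; apply/lee_addgt0Pr => e e0.
by rewrite -EFinD; apply: h; rewrite lte_fin ltrDl.
Qed.

Theorem theorem4p4 (R : realType) (X Y : completeNormedModType R) :
  [/\ (kadets_dist (@bidual_dom R X) (@bidual_norm R X)
                   (@bidual_dom R Y) (@bidual_norm R Y)
       <= kadets_dist (@sp_dom R X) (@sp_norm R X) (@sp_dom R Y) (@sp_norm R Y))%E,
      (forall U : set_system nat, UltraFilter U ->
        (kadets_dist (@linfty_dom R X) (@ultra_norm R X U)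
                     (@linfty_dom R Y) (@ultra_norm R Y U)
         <= kadets_dist (@sp_dom R X) (@sp_norm R X) (@sp_dom R Y) (@sp_norm R Y))%E) &
      (kadets_dist (@bidual_dom R X) (@bidual_quot_norm R X)
                   (@bidual_dom R Y) (@bidual_quot_norm R Y)
       <= 8%:E * kadets_dist (@sp_dom R X) (@sp_norm R X) (@sp_dom R Y) (@sp_norm R Y))%E].
Proof.
split=> [|U UU|].
- apply: lee_of_lt_fin => d /coupling_of_kadets_dist [N].
  exact: kadets_dist_bidual_le.
- apply: lee_of_lt_fin => d /coupling_of_kadets_dist [N].
  exact: kadets_dist_ultrapower_le.
(* The factor moves to the other side, so the coupling has constant [d / 8]. *)
- apply: lee_of_lt_fin => d; rewrite muleC -lte_pdivlMr//.
  move=> /coupling_of_kadets_dist [N] /kadets_dist_bidual_quot_le.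
  by rewrite mulrCA mulfV// mulr1.
Qed.
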